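(* Let $\vec X^m\in\underline{V}^h$ with $\vec X^m\,.\,\vec e_1=0$ on $\partial_0I$, let $\Delta t_m>0$, and let $(\vec X^{m+1},\kappa_g^{m+1})\in\underline{V}^h\times W^h_{\partial_0}$ be a solution to the following fully discrete scheme $(\mathcal{C}_{m,\star})^h$: $\vec X^{m+1}-\vec X^m\in\mathbb{X}^h$ and $$\left(g(\vec X^m)\,\frac{\vec X^{m+1}-\vec X^m}{\Delta t_m},\chi\,\vec\nu^m\,|\vec X^m_\rho|\right)^h=\left(g^{\frac12}(\vec X^m)\,\kappa_g^{m+1},\chi\,|\vec X^m_\rho|\right)^h\quad\forall\ \chi\in W^h_{\partial_0},$$ $$\begin{aligned}&\left(g(\vec X^m)\,\kappa_g^{m+1}\,\vec\nu^m,\vec\eta\,|\vec X^m_\rho|\right)^h+\left(\nabla\,[g^{\frac12}_+(\vec X^{m+1})+g^{\frac12}_-(\vec X^m)],\vec\eta\,|\vec X^{m+1}_\rho|\right)^h\\&\quad+\left(g^{\frac12}(\vec X^m)\,\vec X^{m+1}_\rho,\vec\eta_\rho\,|\vec X^m_\rho|^{-1}\right)^h=0\quad\forall\ \vec\eta\in\mathbb{X}^h.\end{aligned}$$ Then it holds that $$L_g^h(\vec X^{m+1})+\Delta t_m\left(g^{\frac12}(\vec X^m)\,|\kappa_g^{m+1}|^2,|\vec X^m_\rho|\right)^h\le L_g^h(\vec X^m),$$ where $L^h_g(\vec Z)=\left(g^{\frac12}(\vec Z),|\vec Z_\rho|\right)^h$ for $\vec Z\in\underline{V}^h$.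
   Context: Metric: $H\subset\mathbb{R}^2$ is a domain and $g:H\to\mathbb{R}_{>0}$ is a smooth positive function. $\vec e_1,\vec e_2$ is the standard basis of $\mathbb{R}^2$; a dot between vectors is the Euclidean inner product; $\cdot^\perp$ is clockwise rotation by $\frac\pi2$. Splitting: it is assumed that $g^{\frac12}=g^{\frac12}_++g^{\frac12}_-$ with differentiable functions such that $\pm g^{\frac12}_\pm$ is convex in $H$, in the sense that the tangent inequalities hold, so that $$\left[\nabla g^{\frac12}_+(\vec u)+\nabla g^{\frac12}_-(\vec v)\right].\,(\vec u-\vec v)\ge g^{\frac12}(\vec u)-g^{\frac12}(\vec v)\quad\forall\ \vec u,\vec v\in H.$$ The notation $\nabla[g^{\frac12}_+(\vec X^{m+1})+g^{\frac12}_-(\vec X^m)]$ means $(\nabla g^{\frac12}_+)(\vec X^{m+1})+(\nabla g^{\frac12}_-)(\vec X^m)$. Parameter domain: either $I=\mathbb{R}/\mathbb{Z}$ (closed curve), with $\partial I=\emptyset$, or $I=(0,1)$ (open curve), with $\partial I=\{0,1\}$. $\partial I=\partial_0I\cup\partial_1I\cup\partial_2I\cup\partial_DI$ is a given disjoint partition. The set $\partial_0I$ may be nonempty only if $H=\{\vec z\in\mathbb{R}^2:\vec z\,.\,\vec e_1>0\}$ and either $g(\vec z)=(\vec z\,.\,\vec e_1)^{-2\mu}$ with $\mu\le-1$, or $g(\vec z)=(\vec z\,.\,\vec e_1)^{2(n-1)}e^{-\frac12|\vec z|^2}$ with an integer $n\ge2$; in these cases $g$, $g^{\frac12}$ and $g^{\frac12}_\pm$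 are extended $C^1$ up to the $x_2$-axis, where $g=0$. Finite element spaces: for an integer $J\ge3$, $h=J^{-1}$, $q_j=jh$, $I_j=[q_{j-1},q_j]$ (with $q_0$ and $q_J$ identified if $I=\mathbb{R}/\mathbb{Z}$). $V^h=\{\chi\in C(\overline I):\chi|_{I_j}\text{ affine},\ j=1,\dots,J\}$, $\underline{V}^h=[V^h]^2$, $W^h_{\partial_0}=\{\chi\in V^h:\chi(\rho)=0\ \forall\rho\in\partial_0I\}$, and $\mathbb{X}^h=\{\vec\eta\in\underline{V}^h:\vec\eta\,.\,\vec e_1=0\text{ on }\partial_0I,\ \vec\eta=\vec0\text{ on }\partial_DI,\ \vec\eta\,.\,\vec e_i=0\text{ on }\partial_iI,\ i=1,2\}$. Mass-lumped inner product: for piecewise continuous $u,v$ with possible jumps at the nodes, $(u,v)^h=\frac12h\sum_{j=1}^J[(uv)(q_j^-)+(uv)(q_{j-1}^+)]$, where $\pm$ denotes one-sided limits; for vector-valued functions the product is the Euclidean inner product. Subscript $\rho$ denotes the derivative with respect to $\rho$; $\vec\nu^m=-(\vec X^m_\rho/|\vec X^m_\rho|)^\perp$. It is understood that $|\vec X^m_\rho|>0$ almost everywhere, and that $\vec X^m$ and $\vec X^{m+1}$ take values in $H$ on $\overline I\setminus\partial_0I$. *)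

(* Defs.v *)
From HB Require Import structures.
From mathcomp Require Import all_boot all_order all_algebra.
From mathcomp Require Import all_classical all_reals all_analysis.

Set Implicit Arguments.
Unset Strict Implicit.
Unset Printing Implicit Defensive.

Import Order.TTheory GRing.Theory Num.Theory.
Import numFieldNormedType.Exports.

Local Open Scope classical_set_scope.
Local Open Scope ring_scope.

Section Plane.
Context {R : realType}.
Implicit Types (u v z : 'rV[R]_2) (H : set 'rV[R]_2) (f : 'rV[R]_2 -> R).

Definition dot u v : R := \sum_i u 0 i * v 0 i.

(* The library norm on 'rV[R]_2 is the sup norm. *)
Definition enorm v : R := Num.sqrt (dot v v).

(* clockwise rotation by pi/2 *)
Definition perp v : 'rV[R]_2 := \row_i (if i == 0 then v 0 1 else - v 0 0).

Definition partial (i : 'I_2) f : 'rV[R]_2 -> R :=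
  fun z => 'D_(delta_mx 0 i) f z.

Definition grad f z : 'rV[R]_2 := \row_i partial i f z.

Definition smooth_on H f : Prop :=
  forall s : seq 'I_2, let F := foldr partial f s in
  forall z, H z -> {for z, continuous F} /\
    forall i : 'I_2, derivable F z (delta_mx 0 i).

(* Convexity of a differentiable function in the sense of tangent
   inequalities; H itself need not be convex. *)
Definition tangent_convex H f : Prop :=
  forall u v, H u -> H v -> f u - f v <= dot (grad f u) (u - v).

Definition sqrt_splitting H (g gp gm : 'rV[R]_2 -> R) : Prop :=
  [/\ forall z, H z -> Num.sqrt (g z) = gp z + gm z,
      forall z, H z -> differentiable gp z /\ differentiable gm z,
      tangent_convex H gp
    & tangent_convex H (fun z => - gm z)].

(* C^1 up to the boundary: on closure H the values of f are the continuous
   extension, and the gradient in H has a limit at every point of closure H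
   (at z in H this limit is grad f z, since within H (nbhs z) contains z). *)
Definition C1_closure H f : Prop :=
  [/\ forall z, H z -> differentiable f z,
      {within closure H, continuous f}
    & forall z, closure H z -> cvg (grad f @ within H (nbhs z))].

Definition axis_metric H (g gp gm : 'rV[R]_2 -> R) : Prop :=
  [/\ H = [set z | 0 < z 0 0],
      (exists2 mu : R, mu <= -1 &
         forall z, H z -> g z = z 0 0 `^ (- 2 * mu)) \/
      (exists2 n : nat, (2 <= n)%N &
         forall z, H z ->
           g z = z 0 0 ^+ (2 * (n - 1))%N * expR (- (1 / 2) * enorm z ^+ 2)),
      [/\ C1_closure H g, C1_closure H (fun z => Num.sqrt (g z)),
          C1_closure H gp & C1_closure H gm]
    & forall z, z 0 0 = 0 -> g z = 0].

End Plane.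

Variant param_domain := ClosedCurve | OpenCurve.

Variant bdry_label := B0 | B1 | B2 | BD.

(* Functions on the closure of I are represented by functions on R, of which
   only the restriction to [0, 1] matters; for I = R/Z the values at 0 and 1
   have to agree. *)
Section FiniteElements.
Context {R : realType}.
Implicit Types (I : param_domain) (dI : bdry_label -> set R) (J : nat).

Definition boundary I : set R :=
  match I with ClosedCurve => set0 | OpenCurve => [set 0; 1] end.

Definition bdry_partition I dI : Prop :=
  trivIset setT dI /\ \bigcup_k dI k = boundary I.

Definition node J (j : nat) : R := j%:R / J%:R.

Definition Vh I J (chi : R -> R) : Prop :=
  [/\ {within `[0, 1], continuous chi},
      I = ClosedCurve -> chi 0 = chi 1
    & forall j, (j < J)%N -> exists a b : R,
        forall rho, rho \in `[node J j, node J j.+1] -> chi rho = a + b * rho].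

Definition vecVh I J (eta : R -> 'rV[R]_2) : Prop :=
  forall i : 'I_2, Vh I J (fun rho => eta rho 0 i).

Definition Wh I dI J (chi : R -> R) : Prop :=
  Vh I J chi /\ forall rho, dI B0 rho -> chi rho = 0.

Definition Xh I dI J (eta : R -> 'rV[R]_2) : Prop :=
  vecVh I J eta /\
  [/\ forall rho, dI B0 rho -> eta rho 0 0 = 0,
      forall rho, dI BD rho -> eta rho = 0,
      forall rho, dI B1 rho -> eta rho 0 0 = 0
    & forall rho, dI B2 rho -> eta rho 0 1 = 0].

Definition lumped J (w : R -> R) : R :=
  1 / 2 * J%:R^-1 * \sum_(j < J)
    (lim (w @ (node J j.+1)^'-) + lim (w @ (node J j)^'+)).

Definition ip J (u v : R -> R) : R := lumped J (fun rho => u rho * v rho).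

Definition vecip J (u v : R -> 'rV[R]_2) : R :=
  lumped J (fun rho => dot (u rho) (v rho)).

(* All derivatives are only meaningful off the nodes; the inner products use
   one-sided limits and so never evaluate them at a node. *)
Definition speed (X : R -> 'rV[R]_2) (rho : R) : R := enorm (X^`()%classic rho).

Definition normal (X : R -> 'rV[R]_2) (rho : R) : 'rV[R]_2 :=
  - perp ((speed X rho)^-1 *: X^`()%classic rho).

Definition Lgh J (g : 'rV[R]_2 -> R) (Z : R -> 'rV[R]_2) : R :=
  ip J (fun rho => Num.sqrt (g (Z rho))) (speed Z).

Definition admissible dI (H : set 'rV[R]_2) (X : R -> 'rV[R]_2) : Prop :=
  forall rho, 0 <= rho <= 1 -> ~ dI B0 rho -> H (X rho).

Definition scheme I dI J (g gp gm : 'rV[R]_2 -> R) (dt : R)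
    (Xm X1 : R -> 'rV[R]_2) (kappa : R -> R) : Prop :=
  [/\ Xh I dI J (fun rho => X1 rho - Xm rho),
      forall chi, Wh I dI J chi ->
        vecip J (fun rho => g (Xm rho) *: (dt^-1 *: (X1 rho - Xm rho)))
                (fun rho => (chi rho * speed Xm rho) *: normal Xm rho)
        = ip J (fun rho => Num.sqrt (g (Xm rho)) * kappa rho)
               (fun rho => chi rho * speed Xm rho)
    & forall eta, Xh I dI J eta ->
        vecip J (fun rho => (g (Xm rho) * kappa rho) *: normal Xm rho)
                (fun rho => speed Xm rho *: eta rho)
        + vecip J (fun rho => grad gp (X1 rho) + grad gm (Xm rho))
                  (fun rho => speed X1 rho *: eta rho)
        + vecip J (fun rho => Num.sqrt (g (Xm rho)) *: X1^`()%classic rho)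
                  (fun rho => (speed Xm rho)^-1 *: eta^`()%classic rho)
        = 0].

End FiniteElements.

(* Main.v *)
Require Import Defs.
From HB Require Import structures.
From mathcomp Require Import all_boot all_order all_algebra.
From mathcomp Require Import all_classical all_reals all_analysis.
From mathcomp Require Import ring lra.

Set Implicit Arguments.
Unset Strict Implicit.
Unset Printing Implicit Defensive.

Import Order.TTheory GRing.Theory Num.Theory.
Import numFieldNormedType.Exports.

Local Open Scope classical_set_scope.
Local Open Scope ring_scope.

(** The energy bound follows by testing the scheme with its own solution. With
    [chi = kappa] in the first equation and [eta = X1 - Xm] in the second, the
    curvature term of the second equation becomes exactly the dissipation
    [dt * (g^(1/2)(Xm) |kappa|^2, |Xm_rho|)^h]. So it suffices to bound the two
    remaining terms of the second equation from below by
    [Lgh X1 - Lgh Xm], and this can be done pointwise on each open cell, from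

      [a s1 - b s0 = s1 (a - b) + b (s1 - s0)]

    with [a], [b] the values of [g^(1/2)] and [s1], [s0] the speeds of [X1] and
    [Xm]: the convex/concave splitting bounds [a - b] by the gradient term
    ([splitting_le]), and Cauchy-Schwarz together with the square of [s1 - s0]
    bounds [s1 - s0] by the stiffness term ([enorm_sub_le]).

    The rest of the work is to pass from the open cells to the mass-lumped
    products, which are built from one-sided limits at the nodes. A limit is
    additive and monotone only if it exists, so each integrand must be shown to
    have one-sided limits ([has_traces]). On a cell the curves are affine, hence
    their derivatives are constant and the question reduces to the limits of
    [g], [g^(1/2)] and the two gradients at the end points of a cell. At a point
    of [H] the gradients are continuous because a differentiable function
    satisfying the tangent inequalities is automatically C^1
    ([tangent_convex_partial_continuous]); at a point of the axis the assumed
    C^1 extension provides the limits. *)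

(** * Euclidean geometry of the plane *)

Section PlaneGeometry.
Context {R : realType}.
Implicit Types (u v a b : 'rV[R]_2) (c : R).

Lemma dotE u v : dot u v = u 0 0 * v 0 0 + u 0 1 * v 0 1.
Proof.
rewrite /dot !big_ord_recl big_ord0 addr0; congr (_ + _ * _);
  by congr (_ _ _); apply: val_inj.
Qed.

Lemma dotC u v : dot u v = dot v u.
Proof. by rewrite !dotE; ring. Qed.

Lemma dotZl c u v : dot (c *: u) v = c * dot u v.
Proof. by rewrite !dotE !mxE; ring. Qed.

Lemma dotZr c u v : dot u (c *: v) = c * dot u v.
Proof. by rewrite !dotE !mxE; ring. Qed.

Lemma dotDl u1 u2 v : dot (u1 + u2) v = dot u1 v + dot u2 v.
Proof. by rewrite !dotE !mxE; ring. Qed.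

Lemma dotBr u v1 v2 : dot u (v1 - v2) = dot u v1 - dot u v2.
Proof. by rewrite !dotE !mxE; ring. Qed.

Lemma dot_delta (v : 'rV[R]_2) i : dot v (delta_mx 0 i) = v 0 i.
Proof.
rewrite /dot (bigD1 i) //= big1 ?addr0 => [|j /negPf ji].
  by rewrite mxE !eqxx mulr1.
by rewrite mxE ji andbF mulr0.
Qed.

Lemma dot_ge0 u : 0 <= dot u u.
Proof. by rewrite dotE -!expr2 addr_ge0 ?sqr_ge0. Qed.

Lemma enorm_ge0 u : 0 <= enorm u.
Proof. exact: sqrtr_ge0. Qed.

Lemma sqr_enorm u : enorm u ^+ 2 = dot u u.
Proof. by rewrite sqr_sqrtr ?dot_ge0. Qed.

(** Cauchy-Schwarz, from Lagrange's identity in the plane. *)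
Lemma dot_le_enorm u v : dot u v <= enorm u * enorm v.
Proof.
have [uv0|uv0] := leP (dot u v) 0.
  by apply: le_trans uv0 _; rewrite mulr_ge0 ?enorm_ge0.
rewrite -(ler_pXn2r (n := 2)) ?nnegrE ?(ltW uv0) ?mulr_ge0 ?enorm_ge0 //.
rewrite exprMn !sqr_enorm !dotE.
by have := sqr_ge0 (u 0 0 * v 0 1 - u 0 1 * v 0 0); nra.
Qed.

(** The linearised change of length controls the true one: after
    Cauchy-Schwarz, multiplied by [enorm a], the right-hand side exceeds the
    left-hand side by [(enorm b - enorm a) ^+ 2]. *)
Lemma enorm_sub_le a b : 0 < enorm a ->
  enorm b - enorm a <= dot b ((enorm a)^-1 *: (b - a)).
Proof.
move=> a0; rewrite dotZr dotBr -sqr_enorm mulrC ler_pdivlMr//.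
have := dot_le_enorm b a; have := sqr_ge0 (enorm b - enorm a); nra.
Qed.

Lemma cvg_dot {T : Type} (F : set_system T) {FF : Filter F}
    (p q : T -> 'rV[R]_2) :
  (forall i, cvg (p x 0 i @[x --> F])) ->
  (forall i, cvg (q x 0 i @[x --> F])) ->
  cvg (dot (p x) (q x) @[x --> F]).
Proof.
move=> cp cq; under eq_fun do rewrite dotE.
by apply: is_cvgD; apply: is_cvgM.
Qed.

Lemma cvg_coord {T : Type} (F : set_system T) {FF : Filter F}
    (p : T -> 'rV[R]_2) i :
  cvg (p @ F) -> cvg (p x 0 i @[x --> F]).
Proof.
move=> cp; apply/cvg_ex; exists ((lim (p @ F)) 0 i).
have cc := @coord_continuous R 1 2 0 i (lim (p @ F)).
exact: (cvg_comp _ _ cp cc).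
Qed.

End PlaneGeometry.

(** * Continuity of the gradient of a convex function *)

(** The tangent inequality at [w] bounds the partial derivative there by the
    difference quotients of [f] at [w]: from above for steps [h > 0], from below
    for [h < 0]. A quotient with a fixed step is continuous in [w], and at [z]
    it is close to the partial derivative once the step is small. So one step of
    each sign, chosen at [z], traps the partial derivative at all [w] near
    [z]. *)
Lemma tangent_convex_partial_continuous {R : realType} {H : set 'rV[R]_2}
    {f} {i} {z} :
  open H -> (forall w, H w -> differentiable f w) -> tangent_convex H f ->
  H z -> partial i f @ z --> partial i f z.
Proof.
move=> oH df tf Hz; set e : 'rV[R]_2 := delta_mx 0 i.
have fc w : H w -> {for w, continuous f}.
  by move=> /df; exact: differentiable_continuous.
pose Q h w := h^-1 * (f (h *: e + w) - f w).
(* Multiplying by [h] covers both signs of the step at once. *)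
have key h w : H w -> H (h *: e + w) -> h * partial i f w <= h * (Q h w).
  move=> Hw Hhw; have [->|h0] := eqVneq h 0; first by rewrite !mul0r.
  have := tf _ _ Hw Hhw; rewrite opprD addrCA subrr addr0 -scaleNr dotZr.
  by rewrite dot_delta mxE /Q mulrA divff // mul1r; lra.
have Qz : Q h z @[h --> 0^'] --> partial i f z.
  exact: (diff_derivable (df _ Hz)).
have shiftC h : h *: e + w @[w --> z] --> h *: e + z.
  exact: (cvgD (cvg_cst _) cvg_id).
have Qw h : H (h *: e + z) -> Q h w @[w --> z] --> Q h z.
  move=> Hhz; have fhz := cvg_comp _ _ (shiftC h) (fc _ Hhz).
  exact: (cvgM (cvg_cst _) (cvgB fhz (fc _ Hz))).
have shiftH : \forall h \near (0 : R)^', H (h *: e + z).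
  have : h *: e + z @[h --> (0:R)^'] --> (0:R) *: e + z.
    have h0 : h @[h --> (0 : R)^'] --> (0 : R) by exact: cvg_within.
    exact: (cvgD (cvgZ h0 (cvg_cst e)) (cvg_cst z)).
  rewrite scale0r add0r; apply; exact: open_nbhs_nbhs.
apply/(@cvgrPdist_lt _ _ _ (nbhs z) (nbhs_filter z)) => eps eps0.
have eps2 : 0 < eps / 2 by rewrite divr_gt0.
have pick (G : set_system R) : ProperFilter G -> G --> (0 : R)^' ->
    forall P : set R, G P ->
    exists h, P h /\ \forall w \near z,
      `|partial i f z - Q h w| < eps /\ h * partial i f w <= h * Q h w.
  move=> PG G0 P GP.
  have H1 : \forall h \near G, `|partial i f z - Q h z| < eps / 2.
    by apply: G0; have /cvgrPdist_lt := Qz; apply.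
  have H2 : \forall h \near G, H (h *: e + z) by exact: G0.
  have [h [Ph [/= h1 h2]]] := filter_ex (filterI GP (filterI H1 H2)).
  exists h; split => //; near=> w; split.
    rewrite -[X in `|X|](subrKA (Q h z)) (le_lt_trans (ler_normD _ _))//.
    rewrite [ltRHS]splitr ltrD//; near: w.
    by have /cvgrPdist_lt := Qw _ h2; apply.
  apply: key; near: w; first exact: open_nbhs_nbhs.
  by apply: shiftC; exact: open_nbhs_nbhs.
have r0 : 0^'+ --> (0 : R)^' by apply: within_subset => r ?; rewrite gt_eqF.
have l0 : 0^'- --> (0 : R)^' by apply: within_subset => r ?; rewrite lt_eqF.
have [h [h0 hP]] := pick 0^'+ _ r0 _ (@nbhs_right_gt R 0).
have [k [k0 kP]] := pick 0^'- _ l0 _ (@nbhs_left_lt R 0).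
near=> w.
have [+ +] : `|partial i f z - Q h w| < eps /\ h * partial i f w <= h * Q h w.
  by near: w.
have [+ +] : `|partial i f z - Q k w| < eps /\ k * partial i f w <= k * Q k w.
  by near: w.
rewrite (ler_nM2l k0) (ler_pM2l h0) !ltr_norml => /andP[? ?] ? /andP[? ?] ?.
by apply/andP; split; lra.
Unshelve. all: by end_near. Qed.

Lemma splitting_partial_continuous {R : realType} (H : set 'rV[R]_2)
    g gp gm i z :
  open H ->
  sqrt_splitting H g gp gm -> H z ->
  {for z, continuous (partial i gp)} /\ {for z, continuous (partial i gm)}.
Proof.
move=> oH [_ dgpm cp cm] Hz; split.
  by apply: (tangent_convex_partial_continuous oH _ cp) => // w /dgpm[].
have E w : H w -> partial i (fun z => - gm z) w = - partial i gm w.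
  move=> Hw; rewrite /partial deriveN//; apply: diff_derivable.
  by case: (dgpm _ Hw).
have dN w : H w -> differentiable (fun z => - gm z) w.
  by move=> /dgpm[_ d]; exact: differentiableN.
have := tangent_convex_partial_continuous (i := i) oH dN cm Hz.
rewrite E// => /cvgN; rewrite opprK => c.
apply: cvg_trans c; apply: near_eq_cvg; first exact: (nbhs_filter z).
apply: (@filterS _ (nbhs z) (nbhs_filter z)) (open_nbhs_nbhs (conj oH Hz)).
move=> w Hw.
by transitivity (- partial i (fun z => - gm z) w); rewrite // E// opprK.
Qed.

(** The implicit-explicit evaluation of the gradients is what makes both tangent
    inequalities point the same way: the one for [gp] is taken at [u], the one
    for the convex function [- gm] at [v]. *)
Lemma splitting_le {R : realType} (H : set 'rV[R]_2) g gp gm u v :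
  sqrt_splitting H g gp gm -> H u -> H v ->
  Num.sqrt (g u) - Num.sqrt (g v) <= dot (grad gp u + grad gm v) (u - v).
Proof.
move=> [gE dgpm cp cm] Hu Hv; rewrite !gE//.
have := cm _ _ Hv Hu; have := cp _ _ Hu Hv.
have -> : grad (fun z => - gm z) v = - grad gm v.
  apply/rowP => i; rewrite !mxE /partial deriveN//.
  by apply: diff_derivable; case: (dgpm _ Hv).
rewrite dotDl -(opprB u v) -[- grad gm v]scaleN1r -[- (u - v)]scaleN1r.
by rewrite dotZl dotZr; lra.
Qed.

(** * Mass lumping through one-sided limits *)

Lemma cvg_along {T U : topologicalType} {V : ptopologicalType}
    {F : set_system T} {G : set_system U} {X : T -> U} {f : U -> V} :
  X @ F --> G -> cvg (f @ G) -> cvg (f (X x) @[x --> F]).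
Proof.
by move=> XG fG; apply/cvg_ex; exists (lim (f @ G)); exact: cvg_comp XG fG.
Qed.

Section MassLumping.
Context {R : realType}.
Implicit Types (J j : nat) (F : set_system R) (w : R -> R).

(** The two filters of the lumped quadrature attached to the cell [j]; treating
    them together spares a duplicate argument at every node. *)
Definition cell_end J j F : Prop :=
  F = (node J j.+1 : R)^'- \/ F = (node J j : R)^'+.

Lemma cell_end_proper J j F : cell_end J j F -> ProperFilter F.
Proof. by case=> ->; exact _. Qed.

Lemma node_lt J j : (j < J)%N -> node J j < node J j.+1 :> R.
Proof.
by move=> jJ; rewrite /node ltr_pM2r ?ltr_nat// invr_gt0 ltr0n (leq_trans _ jJ).
Qed.

Lemma node_ge0 J j : 0 <= node J j :> R.
Proof. by rewrite /node divr_ge0. Qed.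

Lemma node_le1 J j : (j < J)%N -> node J j.+1 <= 1 :> R.
Proof.
move=> jJ; rewrite /node ler_pdivrMr ?mul1r ?ler_nat//.
by rewrite ltr0n (leq_trans _ jJ).
Qed.

Lemma cell_end_near J j F : (j < J)%N -> cell_end J j F ->
  \forall rho \near F, node J j < rho < node J j.+1.
Proof.
move=> /node_lt nj [] ->; near=> rho; apply/andP; split; near: rho.
- exact: nbhs_left_gt.
- exact: nbhs_left_lt.
- exact: nbhs_right_gt.
- exact: nbhs_right_lt.
Unshelve. all: by end_near. Qed.

Lemma cell_end_cvg J j F : (j < J)%N -> cell_end J j F ->
  exists2 p : R, node J j <= p <= node J j.+1 & F --> p.
Proof.
move=> jJ [] ->; have lt := node_lt jJ.
- exists (node J j.+1); rewrite ?lexx ?ltW//; exact: cvg_within.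
- exists (node J j); rewrite ?lexx ?ltW//; exact: cvg_within.
Qed.

(** The lumped quadrature takes a default value where a one-sided limit fails to
    exist, so its linearity and monotonicity are confined to such functions. *)
Definition has_traces J w : Prop :=
  forall j F, (j < J)%N -> cell_end J j F -> cvg (w @ F).

Lemma has_tracesD J w1 w2 : has_traces J w1 -> has_traces J w2 ->
  has_traces J (fun rho => w1 rho + w2 rho).
Proof.
move=> t1 t2 j F jJ jF; have PF := cell_end_proper jF.
exact: is_cvgD (t1 _ _ jJ jF) (t2 _ _ jJ jF).
Qed.

Lemma has_tracesN J w : has_traces J w -> has_traces J (fun rho => - w rho).
Proof.
move=> t1 j F jJ jF; have PF := cell_end_proper jF.
exact: is_cvgN (t1 _ _ jJ jF).
Qed.

Lemma lumpedD J w1 w2 : has_traces J w1 -> has_traces J w2 ->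
  lumped J (fun rho => w1 rho + w2 rho) = lumped J w1 + lumped J w2.
Proof.
move=> t1 t2; rewrite /lumped -mulrDr -big_split/=; congr (_ * _).
apply: eq_bigr => j _; have jJ := ltn_ord j.
have l F : cell_end J j F ->
    lim (w1 rho + w2 rho @[rho --> F]) = lim (w1 @ F) + lim (w2 @ F).
  move=> jF; have PF := cell_end_proper jF.
  exact: limD (t1 _ _ jJ jF) (t2 _ _ jJ jF).
by rewrite !l; [rewrite addrACA | right | left].
Qed.

Lemma lumpedZ J (c : R) w : has_traces J w ->
  lumped J (fun rho => c * w rho) = c * lumped J w.
Proof.
move=> t; rewrite /lumped mulrCA; congr (_ * _); rewrite mulr_sumr.
apply: eq_bigr => j _; have jJ := ltn_ord j.
have l F : cell_end J j F -> lim (c * w rho @[rho --> F]) = c * lim (w @ F).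
  move=> jF; have PF := cell_end_proper jF.
  exact: limZl_tmp (t _ _ jJ jF).
by rewrite !l; [rewrite mulrDr | right | left].
Qed.

Lemma lumpedB J w1 w2 : has_traces J w1 -> has_traces J w2 ->
  lumped J (fun rho => w1 rho - w2 rho) = lumped J w1 - lumped J w2.
Proof.
move=> t1 t2; rewrite lumpedD//; last exact: has_tracesN.
rewrite -[- lumped J w2]mulN1r -lumpedZ//; congr (_ + lumped J _).
by apply/funext => rho; rewrite mulN1r.
Qed.

Lemma ler_lumped J w1 w2 : has_traces J w1 -> has_traces J w2 ->
  (forall j rho, (j < J)%N -> node J j < rho < node J j.+1 ->
     w1 rho <= w2 rho) ->
  lumped J w1 <= lumped J w2.
Proof.
move=> t1 t2 w12; rewrite /lumped ler_wpM2l ?mulr_ge0 ?invr_ge0//.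
apply: ler_sum => j _; have jJ := ltn_ord j.
have l F : cell_end J j F -> lim (w1 @ F) <= lim (w2 @ F).
  move=> jF; have PF := cell_end_proper jF.
  apply: (ler_lim (t1 _ _ jJ jF) (t2 _ _ jJ jF)).
  by apply: filterS (cell_end_near jJ jF) => rho; exact: w12.
by apply: lerD; apply: l; [left|right].
Qed.

End MassLumping.

(** * Limits of finite element curves at the nodes *)

Section FiniteElementTraces.
Context {R : realType}.
Implicit Types (I : param_domain) (dI : bdry_label -> set R) (J j : nat).
Implicit Types (F : set_system R) (X Y : R -> 'rV[R]_2) (H : set 'rV[R]_2).

Lemma vecVh_cell I J X j : vecVh I J X -> (j < J)%N ->
  exists A B, forall rho, node J j <= rho <= node J j.+1 ->
    X rho = A + rho *: B.
Proof.
move=> XV jJ.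
have [_ _ /(_ j jJ) [a0 [b0 E0]]] := XV 0.
have [_ _ /(_ j jJ) [a1 [b1 E1]]] := XV 1.
exists (\row_i (if i == 0 then a0 else a1)).
exists (\row_i (if i == 0 then b0 else b1)).
move=> rho rhoj; apply/rowP => i; rewrite !mxE.
have [->|i0] := eqVneq i 0; first by rewrite E0// mulrC.
have -> : i = 1 by case: i i0 => [[|[|]]]// ? ?; exact: val_inj.
by rewrite E1// mulrC.
Qed.

Lemma derive1_affine X A B (a b rho : R) :
  (forall r, a < r < b -> X r = A + r *: B) -> a < rho < b ->
  X^`()%classic rho = B.
Proof.
move=> XE rab; apply: lim_near_cst => //.
have inab : \forall h \near (0 : R)^', a < h + rho < b.
  have [d d0 dab] : exists2 d : R, 0 < d &
      forall h, `|h| < d -> a < h + rho < b.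
    move: rab => /andP[ar rb]; exists (Num.min (rho - a) (b - rho)).
      by rewrite lt_min !subr_gt0 ar rb.
    by move=> h; rewrite lt_min !ltr_norml; lra.
  by near=> h; apply: dab; near: h; exact: dnbhs0_lt.
near=> h; have h0 : h != 0 by near: h; exact: nbhs_dnbhs_neq.
rewrite !XE//; last by near: h.
by rewrite opprD addrACA subrr add0r -scalerBl addrK scalerA mulVf// scale1r.
Unshelve. all: by end_near. Qed.

Lemma derive1_cell I J X j : vecVh I J X -> (j < J)%N ->
  exists B, forall rho, node J j < rho < node J j.+1 -> X^`()%classic rho = B.
Proof.
move=> XV jJ; have [A [B XE]] := vecVh_cell XV jJ.
exists B => rho; apply: (derive1_affine (A := A)) => r /andP[? ?].
by apply: XE; rewrite !ltW.
Qed.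

Lemma derive1_cellB I J j X Y rho :
  vecVh I J X -> vecVh I J Y -> (j < J)%N -> node J j < rho < node J j.+1 ->
  (fun r => Y r - X r)^`()%classic rho = Y^`()%classic rho - X^`()%classic rho.
Proof.
move=> XV YV jJ rj.
have [A [B XE]] := vecVh_cell XV jJ.
have [C [D YE]] := vecVh_cell YV jJ.
have open_cell (Z : R -> 'rV[R]_2) M N :
    (forall r, node J j <= r <= node J j.+1 -> Z r = M + r *: N) ->
    Z^`()%classic rho = N.
  move=> ZE; apply: (derive1_affine (A := M) _ rj) => r /andP[? ?].
  by rewrite ZE// !ltW.
rewrite (open_cell _ _ _ XE) (open_cell _ _ _ YE).
rewrite (open_cell _ (C - A) (D - B))//.
by move=> r rj'; rewrite XE// YE// scalerBr opprD addrACA.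
Qed.

Lemma const_trace J j F (f : R -> R) c : (j < J)%N -> cell_end J j F ->
  (forall rho, node J j < rho < node J j.+1 -> f rho = c) -> cvg (f @ F).
Proof.
move=> jJ jF fE; have PF := cell_end_proper jF.
apply: (@is_cvg_near_cst _ _ c).
by apply: filterS (cell_end_near jJ jF) => rho /fE.
Qed.

Lemma vecVh_trace I J X j F : vecVh I J X -> (j < J)%N -> cell_end J j F ->
  exists2 p, node J j <= p <= node J j.+1 & X @ F --> X p.
Proof.
move=> XV jJ jF; have PF := cell_end_proper jF.
have [A [B XE]] := vecVh_cell XV jJ.
have [p pj Fp] := cell_end_cvg jJ jF; exists p => //.
have l : A + rho *: B @[rho --> F] --> X p.
  rewrite XE//; exact: (cvgD (cvg_cst A) (cvgZ Fp (cvg_cst B))).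
apply: cvg_trans l; apply: near_eq_cvg.
apply: filterS (cell_end_near jJ jF) => rho /andP[? ?].
by rewrite XE ?ltW.
Qed.

Lemma Vh_trace I J chi j F : Vh I J chi -> (j < J)%N -> cell_end J j F ->
  cvg (chi @ F).
Proof.
move=> [_ _ chiE] jJ jF; have PF := cell_end_proper jF.
have [a [b E]] := chiE j jJ; have [p _ Fp] := cell_end_cvg jJ jF.
apply/cvg_ex; exists (a + b * p).
apply: cvg_trans (cvgD (cvg_cst a) (cvgM (cvg_cst b) Fp)).
apply: near_eq_cvg; apply: filterS (cell_end_near jJ jF) => rho /andP[? ?].
by rewrite E// in_itv/= !ltW.
Qed.

(** The speed is constant on an open cell, which has positive measure; so it
    cannot vanish there without vanishing on a non-negligible set. *)
Lemma speed_gt0 I J X j : vecVh I J X -> (j < J)%N ->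
  {ae @lebesgue_measure R, forall rho, 0 < rho < 1 -> 0 < speed X rho} ->
  forall rho, node J j < rho < node J j.+1 -> 0 < speed X rho.
Proof.
move=> XV jJ aeX rho rhoj; have [B BE] := derive1_cell XV jJ.
rewrite /speed BE// lt_neqAle enorm_ge0 andbT; apply/eqP => B0.
have neg : lebesgue_measure.-negligible [set` `]node J j, (node J j.+1 : R)[].
  apply: negligibleS aeX => r /=; rewrite in_itv/= => rj.
  rewrite /speed BE // -B0 ltxx => speed0.
  suff /speed0 : 0 < r < 1 by [].
  case/andP: rj => j1 j2; rewrite (le_lt_trans (node_ge0 J j) j1).
  exact: lt_le_trans j2 (node_le1 jJ).
have : lebesgue_measure [set` `]node J j, (node J j.+1 : R)[] = 0%E.
  by apply: measure_negligible => //; exact: measurable_itv.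
rewrite lebesgue_measure_itv/= lte_fin node_lt// -EFinD => /eqP.
by rewrite eqe subr_eq0 gt_eqF// node_lt.
Qed.

Lemma admissible_interior I dI J H X j rho : bdry_partition I dI ->
  admissible dI H X -> (j < J)%N -> node J j < rho < node J j.+1 -> H (X rho).
Proof.
move=> [_ dIE] XH jJ /andP[r1 r2].
have r0 := le_lt_trans (node_ge0 J j) r1.
have r1' := lt_le_trans r2 (node_le1 jJ).
apply: XH; first by rewrite !ltW.
move=> B0r; have : boundary I rho by rewrite -dIE; exists B0.
by case: (I) => //= -[] E; move: r0 r1'; rewrite E ltxx.
Qed.

(** At a node the curve either stays in [H] or, at a node in [dI B0], touches its
    closure; in both cases it approaches the limit through [H], where the metric
    is controlled. *)
Lemma admissible_trace I dI J H X j F : vecVh I J X -> bdry_partition I dI ->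
  admissible dI H X -> (j < J)%N -> cell_end J j F ->
  exists2 z, X @ F --> within H (nbhs z) &
    H z \/ closure H z /\ dI B0 !=set0.
Proof.
move=> XV pI XH jJ jF; have PF := cell_end_proper jF.
have [p /andP[p0 p1] Xp] := vecVh_trace XV jJ jF.
have nH : \forall rho \near F, H (X rho).
  apply: filterS (cell_end_near jJ jF) => rho.
  exact: admissible_interior pI XH jJ.
exists (X p).
  move=> P; rewrite /within/= => /Xp /= XP.
  by apply: filterS2 nH XP => rho Hr; apply.
have [B0p|nB0p] := pselect (dI B0 p); [right; split|left]; last 2 first.
- by exists p.
- apply: XH => //; rewrite (le_trans (node_ge0 J j) p0).
  exact: le_trans p1 (node_le1 jJ).
move=> N /Xp XN; have [r [HX NX]] := filter_ex (filterI nH XN).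
by exists (X r).
Qed.

End FiniteElementTraces.

(** * Limits of the integrands at the nodes *)

Lemma metric_traces {R : realType} (H : set 'rV[R]_2) g gp gm z :
  open H -> smooth_on H g ->
  sqrt_splitting H g gp gm -> H z \/ closure H z /\ axis_metric H g gp gm ->
  [/\ cvg (g @ within H (nbhs z)),
     cvg (Num.sqrt (g w) @[w --> within H (nbhs z)]) &
     forall i, cvg (partial i gp @ within H (nbhs z)) /\
               cvg (partial i gm @ within H (nbhs z))].
Proof.
move=> oH sg spl.
have cc f : {for z, continuous f} -> cvg (f @ within H (nbhs z)).
  by move=> fc; apply/cvg_ex; exists (f z); exact: cvg_within_filter.
move=> [Hz|[cHz [_ _ [[_ gc _] [_ sc _] [_ _ pc] [_ _ mc]] _]]]; split.
- by apply: cc; have [] := sg [::] z Hz.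
- apply: cc; have [gc _] := sg [::] z Hz.
  exact: continuous_comp gc (@sqrt_continuous R (g z)).
- move=> i; have [? ?] := splitting_partial_continuous i oH spl Hz.
  by split; exact: cc.
- have /subspace_continuousP/(_ z cHz) c := gc.
  apply/cvg_ex; exists (g z); apply: cvg_trans c; apply: cvg_app.
  by apply: within_subset; exact: subset_closure.
- have /subspace_continuousP/(_ z cHz) c := sc.
  apply/cvg_ex; exists (Num.sqrt (g z)); apply: cvg_trans c; apply: cvg_app.
  by apply: within_subset; exact: subset_closure.
- move=> i; have gradE f : partial i f = fun w => grad f w 0 i.
    by apply/funext => w; rewrite mxE.
  by split; rewrite gradE; apply: cvg_coord; [exact: pc|exact: mc].
Qed.

Section LumpedTerms.
Context {R : realType} (H : set 'rV[R]_2) (g gp gm : 'rV[R]_2 -> R)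
    (I : param_domain) (dI : bdry_label -> set R) (J : nat).
Context (openH : open H) (smooth_g : smooth_on H g)
    (splitting : sqrt_splitting H g gp gm)
    (partition_dI : bdry_partition I dI)
    (axis : dI B0 !=set0 -> axis_metric H g gp gm).
Implicit Types (X Y Z : R -> 'rV[R]_2) (F : set_system R).

Lemma metric_along X j F : vecVh I J X -> admissible dI H X ->
  (j < J)%N -> cell_end J j F ->
  [/\ cvg (g (X rho) @[rho --> F]), cvg (Num.sqrt (g (X rho)) @[rho --> F]) &
     forall i, cvg (partial i gp (X rho) @[rho --> F]) /\
               cvg (partial i gm (X rho) @[rho --> F])].
Proof.
move=> XV XH jJ jF; have PF := cell_end_proper jF.
have [z Xz Hz] := admissible_trace XV partition_dI XH jJ jF.
have Hz' : H z \/ closure H z /\ axis_metric H g gp gm.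
  by case: Hz => [|[? /axis]]; [left|right].
have [cg cs cpm] := metric_traces openH smooth_g splitting Hz'.
split; [exact: cvg_along Xz cg| exact: cvg_along Xz cs|].
move=> i; have [cp cm] := cpm i.
by split; [exact: cvg_along Xz cp|exact: cvg_along Xz cm].
Qed.

Lemma speed_trace X j F : vecVh I J X -> (j < J)%N -> cell_end J j F ->
  cvg (speed X @ F).
Proof.
move=> XV jJ jF; have [B BE] := derive1_cell XV jJ.
by apply: (const_trace (c := enorm B) jJ jF) => rho /BE; rewrite /speed => ->.
Qed.

Lemma length_traces X Y : vecVh I J X -> admissible dI H X -> vecVh I J Y ->
  has_traces J (fun rho => Num.sqrt (g (X rho)) * speed Y rho).
Proof.
move=> XV XH YV j F jJ jF; have PF := cell_end_proper jF.
have [_ cs _] := metric_along XV XH jJ jF.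
exact: (is_cvgM cs (speed_trace YV jJ jF)).
Qed.

Lemma vecVh_coord_trace X j F i : vecVh I J X -> (j < J)%N -> cell_end J j F ->
  cvg (X rho 0 i @[rho --> F]).
Proof. by move=> XV; apply: Vh_trace; exact: XV. Qed.

Lemma velocity_traces X Y chi (dt : R) :
  vecVh I J X -> admissible dI H X -> vecVh I J Y -> Vh I J chi ->
  has_traces J (fun rho => dot (g (X rho) *: (dt^-1 *: (Y rho - X rho)))
       ((chi rho * speed X rho) *: normal X rho)).
Proof.
move=> XV XH YV chiV j F jJ jF; have PF := cell_end_proper jF.
have [cg _ _] := metric_along XV XH jJ jF.
have cX i := vecVh_coord_trace (i := i) XV jJ jF.
have cY i := vecVh_coord_trace (i := i) YV jJ jF.
have [B BE] := derive1_cell XV jJ.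
have cn i : cvg (normal X rho 0 i @[rho --> F]).
  apply: (const_trace (c := (- perp ((enorm B)^-1 *: B)) 0 i) jJ jF) => rho.
  move=> /BE.
  by rewrite /normal /speed => ->.
apply: cvg_dot => i.
  under eq_fun do rewrite !mxE.
  exact: (is_cvgM cg (is_cvgM (is_cvg_cst _) (is_cvgB (cY i) (cX i)))).
under eq_fun do rewrite mxE.
have cchi := Vh_trace chiV jJ jF; have cs := speed_trace XV jJ jF.
exact: (is_cvgM (is_cvgM cchi cs) (cn i)).
Qed.

Lemma gradient_traces X Y Z : vecVh I J X -> admissible dI H X ->
  vecVh I J Y -> admissible dI H Y -> vecVh I J Z ->
  has_traces J (fun rho => dot (grad gp (Y rho) + grad gm (X rho))
       (speed Y rho *: Z rho)).
Proof.
move=> XV XH YV YH ZV j F jJ jF; have PF := cell_end_proper jF.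
have [_ _ cpX] := metric_along XV XH jJ jF.
have [_ _ cpY] := metric_along YV YH jJ jF.
apply: cvg_dot => i; under eq_fun do rewrite !mxE.
  have [[_ cm] [cp _]] := (cpX i, cpY i); exact: is_cvgD cp cm.
exact: (is_cvgM (speed_trace YV jJ jF) (vecVh_coord_trace (i := i) ZV jJ jF)).
Qed.

Lemma stiffness_traces X Y Z : vecVh I J X -> admissible dI H X ->
  vecVh I J Y -> vecVh I J Z ->
  has_traces J (fun rho => dot (Num.sqrt (g (X rho)) *: Y^`()%classic rho)
       ((speed X rho)^-1 *: Z^`()%classic rho)).
Proof.
move=> XV XH YV ZV j F jJ jF; have PF := cell_end_proper jF.
have [_ cs _] := metric_along XV XH jJ jF.
have [BX BXE] := derive1_cell XV jJ.
have [BY BYE] := derive1_cell YV jJ.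
have [BZ BZE] := derive1_cell ZV jJ.
have cc : cvg (dot (Y^`()%classic rho) ((speed X rho)^-1 *: Z^`()%classic rho)
    @[rho --> F]).
  apply: (const_trace (c := dot BY ((enorm BX)^-1 *: BZ)) jJ jF) => rho rhoj.
  by rewrite /speed BXE// BYE// BZE.
under eq_fun do rewrite dotZl.
exact: (is_cvgM cs cc).
Qed.

End LumpedTerms.

(** * Unconditional stability *)

Theorem theorem4p2 (R : realType)
    (H : set 'rV[R]_2) (g gp gm : 'rV[R]_2 -> R)
    (I : param_domain) (dI : bdry_label -> set R)
    (J : nat) (dt : R) (Xm X1 : R -> 'rV[R]_2) (kappa : R -> R)
    (openH : open H) (connectedH : connected H) (H_neq0 : H !=set0)
    (smooth_g : smooth_on H g) (g_gt0 : forall z, H z -> 0 < g z)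
    (splitting : sqrt_splitting H g gp gm)
    (partition_dI : bdry_partition I dI)
    (axis : dI B0 !=set0 -> axis_metric H g gp gm)
    (J_ge3 : (3 <= J)%N) (dt_gt0 : 0 < dt)
    (Xm_Vh : vecVh I J Xm)
    (Xm_axis : forall rho, dI B0 rho -> Xm rho 0 0 = 0)
    (Xm_H : admissible dI H Xm)
    (Xm_speed : {ae @lebesgue_measure R, forall rho,
                   0 < rho < 1 -> 0 < speed Xm rho})
    (X1_Vh : vecVh I J X1)
    (X1_H : admissible dI H X1)
    (kappa_Wh : Wh I dI J kappa)
    (solution : scheme I dI J g gp gm dt Xm X1 kappa) :
  Lgh J g X1
  + dt * ip J (fun rho => Num.sqrt (g (Xm rho)) * `|kappa rho| ^+ 2) (speed Xm)
  <= Lgh J g Xm.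
Proof.
have [dX_Xh /(_ _ kappa_Wh) eq1 /(_ _ dX_Xh) eq2] := solution.
have [dX_Vh _] := dX_Xh; have [kappa_Vh _] := kappa_Wh.
set A2 := ip J _ _ in eq1.
set E1 := vecip J _ _ in eq2; set E2 := vecip J _ _ in eq2.
set E3 := vecip J _ _ in eq2; set D := ip J _ _.
have combine (l1 lm e1 e2 e3 : R) :
    e1 + e2 + e3 = 0 -> l1 - lm <= e2 + e3 -> l1 + e1 <= lm by lra.
(* The normal velocity tested with [kappa] and the curvature tested with the
   displacement are the same term, up to the factor [dt]. *)
have E1E : E1 = dt * D.
  have -> : D = A2.
    rewrite /D /A2 /ip; congr (lumped _ _); apply/funext => rho.
    by rewrite real_normK ?num_real//; ring.
  rewrite -eq1 -lumpedZ; last first.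
    exact: (velocity_traces openH smooth_g splitting partition_dI axis).
  rewrite /E1 /vecip; congr (lumped _ _); apply/funext => rho.
  rewrite !dotZl !dotZr (dotC (normal _ _)) mulrCA.
  by rewrite (mulrCA _ dt^-1) mulVKf ?gt_eqF//; ring.
have tE2 := gradient_traces openH smooth_g splitting partition_dI axis
  Xm_Vh Xm_H X1_Vh X1_H dX_Vh.
have tE3 := stiffness_traces openH smooth_g splitting partition_dI axis
  Xm_Vh Xm_H X1_Vh dX_Vh.
have tL1 := length_traces openH smooth_g splitting partition_dI axis
  X1_Vh X1_H X1_Vh.
have tLm := length_traces openH smooth_g splitting partition_dI axis
  Xm_Vh Xm_H Xm_Vh.
have split_diff (a b s1 sm : R) :
    a * s1 - b * sm = s1 * (a - b) + b * (s1 - sm) by ring.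
rewrite -E1E; apply: combine eq2 _.
have := ler_lumped (has_tracesD tL1 (has_tracesN tLm)) (has_tracesD tE2 tE3).
rewrite (lumpedB tL1 tLm) (lumpedD tE2 tE3); apply.
move=> j rho jJ rhoj.
have Xm0 := speed_gt0 Xm_Vh jJ Xm_speed rhoj.
have HXm := admissible_interior partition_dI Xm_H jJ rhoj.
have HX1 := admissible_interior partition_dI X1_H jJ rhoj.
rewrite dotZr dotZl (derive1_cellB Xm_Vh X1_Vh jJ rhoj).
rewrite split_diff; apply: lerD; rewrite ler_wpM2l ?enorm_ge0 ?sqrtr_ge0//.
  exact: splitting_le splitting HX1 HXm.
exact: enorm_sub_le Xm0.
Qed.
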